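(* For every positive integer $n$, the number of normalised compositions of size $n$ equals the $n$-th term of the sequence $$2\cdot 2^{n-1} * 2^{\lfloor n/2\rfloor} * \left(2^{n-1}+2^{\lfloor n/2\rfloor}\right)^{-1},$$ where $*$ denotes Dirichlet convolution of sequences indexed by positive integers, $(a*b)_n=\sum_{d\mid n}a_d b_{n/d}$, and the exponent $-1$ denotes the inverse with respect to Dirichlet convolution. Equivalently, with $C(s)=\sum_{n\ge1}2^{n-1}n^{-s}$ and $S(s)=\sum_{n\ge1}2^{\lfloor n/2\rfloor}n^{-s}$, the Dirichlet generating function $R(s)=\sum_{\rho}|\rho|^{-s}$ over normalised compositions $\rho$ satisfies $R(s)=\frac{2C(s)S(s)}{C(s)+S(s)}$.
   Context: A composition $\alpha=(a_1,\dots,a_k)$ of a positive integer $m$ is a list of positive integers with sum $m$; $l(\alpha)=k$ is its length and $|\alpha|=m$ its size. Near concatenation: $(a_1,\dots,a_k)\odot(b_1,\dots,b_\ell)=(a_1,\dots,a_{k-1},a_k+b_1,b_2,\dots,b_\ell)$; $\beta^{\odot n}$ is the $n$-fold near concatenation of $\beta$ with itself; $\cdot$ is ordinary concatenation. The composition of compositions is $\alpha\circ\beta=\beta^{\odot a_1}\cdot\beta^{\odot a_2}\cdots\beta^{\odot a_k}$ (associative, neutral element $(1)$, $|\alpha\circ\beta|=|\alpha||\beta|$). A factorisation $\alpha=\beta\circ\gamma$ is trivial if one of $\beta,\gamma$ equals $(1)$, or both have length $1$, or both have all components equal to $1$. A factorisation $\alpha=\alpha_1\circ\dots\circ\alpha_k$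 is irreducible if no $\alpha_i\circ\alpha_{i+1}$ is trivial and each $\alpha_i$ admits only trivial factorisations; every composition has a unique irreducible factorisation. The reversal of $(a_1,\dots,a_k)$ is $(a_k,\dots,a_1)$, denoted $\alpha^*$; compositions of equal length are ordered lexicographically, and $\alpha$ is lexicographic minimal if $\alpha\le\alpha^*$. A composition is normalised if all factors in its irreducible factorisation are lexicographic minimal. (Normalised compositions of size $n$ are in bijection with distinct ribbon Schur functions of size $n$.) *)

(* Defs.v *)
From mathcomp Require Import all_boot all_order all_algebra finmap.
From mathcomp Require Import boolp classical_sets cardinality.
Set Implicit Arguments.
Unset Strict Implicit.
Unset Printing Implicit Defensive.
Import Order.TTheory GRing.Theory Num.Theory.

Definition is_composition (a : seq nat) : bool :=
  (a != [::]) && all (fun x => 0 < x) a.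

(* On nonempty arguments this is the usual near concatenation; the empty
   sequence is made neutral so that iteration can start from it. *)
Fixpoint near_cat (a b : seq nat) : seq nat :=
  match a, b with
  | [::], _ => b
  | _, [::] => a
  | [:: x], y :: b' => x + y :: b'
  | x :: a', _ => x :: near_cat a' b
  end.

Definition near_pow (b : seq nat) (n : nat) : seq nat :=
  iter n (near_cat b) [::].

Definition compo (a b : seq nat) : seq nat :=
  flatten [seq near_pow b x | x <- a].

Definition trivial_fact (b c : seq nat) : bool :=
  [|| b == [:: 1], c == [:: 1],
      (size b == 1) && (size c == 1)
    | all (pred1 1) b && all (pred1 1) c].

Definition only_trivial_facts (a : seq nat) : Prop :=
  forall b c : seq nat, is_composition b -> is_composition c ->
    a = compo b c -> trivial_fact b c.

(* [:: 1] is neutral for compo, so the foldr below is the product of the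
   members of the nonempty sequence fs. *)
Definition irreducible_fact (a : seq nat) (fs : seq (seq nat)) : Prop :=
  [/\ fs != [::], all is_composition fs, a = foldr compo [:: 1] fs,
      sorted (fun b c => ~~ trivial_fact b c) fs
    & forall b, b \in fs -> only_trivial_facts b].

Definition lex_minimal (a : seq nat) : bool :=
  ((a : seqlexi nat) <= (rev a : seqlexi nat))%O.

Definition normalised (a : seq nat) : Prop :=
  exists2 fs, irreducible_fact a fs & all lex_minimal fs.

Definition normalised_of_size (n : nat) : set (seq nat) :=
  [set a | [/\ is_composition a, normalised a & sumn a = n]]%classic.

(* fset_set is junk on infinite sets, whence the next lemma. *)
Definition num_normalised (n : nat) : nat :=
  #|` fset_set (normalised_of_size n) |%fset.

Lemma composition_bounds a : all (fun x => 0 < x) a ->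
  size a <= sumn a /\ (forall i, nth 0 a i <= sumn a).
Proof.
elim: a => [|x a IH] /=; first by split => // i; rewrite nth_nil.
case/andP=> x0 /IH [sa na]; split; first by rewrite -add1n leq_add.
case=> [|i] /=; first exact: leq_addr.
exact: leq_trans (na i) (leq_addl _ _).
Qed.

Lemma finite_normalised_of_size n : finite_set (normalised_of_size n).
Proof.
pose F (p : 'I_n.+1 * {ffun 'I_n.+1 -> 'I_n.+1}) : seq nat :=
  mkseq (fun i => p.2 (inord i) : nat) p.1.
apply: (@sub_finite_set _ _ (F @` setT)%classic); last first.
  exact/finite_image/finite_finset.
move=> a [/andP[_ /composition_bounds [sa na]] _ an]; rewrite an in sa na.
exists (inord (size a), [ffun i : 'I_n.+1 => inord (nth 0 a i)]) => //.
rewrite /F /= inordK ?ltnS //.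
apply: (@eq_from_nth _ 0); rewrite size_mkseq // => i ia.
by rewrite nth_mkseq // ffunE !inordK ?ltnS // (leq_trans (ltnW ia) sa).
Qed.

Local Open Scope ring_scope.

(* Sequences indexed by positive integers, equivalently formal Dirichlet
   series, are functions on nat whose value at 0 is irrelevant. *)
Definition dconv (f g : nat -> rat) (n : nat) : rat :=
  \sum_(d <- divisors n) f d * g (n %/ d)%N.

Fixpoint dinv_rec (f : nat -> rat) (k n : nat) : rat :=
  if k is k'.+1 then
    (f 1%N)^-1 *
      ((n == 1%N)%:R
        - \sum_(d <- divisors n | d != n) dinv_rec f k' d * f (n %/ d)%N)
  else 0.

(* Every proper divisor of n > 0 is smaller than n, so n steps suffice. *)
Definition dinv (f : nat -> rat) (n : nat) : rat := dinv_rec f n n.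

Lemma dinv_rec_fuel f k n : (0 < n <= k)%N -> dinv_rec f k n = dinv f n.
Proof.
rewrite /dinv; move: {-2}n (leqnn n) => m.
elim: n m k => [|n IH] m k; first by rewrite leqn0 => /eqP ->.
move=> mn; case: m mn => // m mn; case: k => // k /= mk.
congr (_ * (_ - _)); rewrite [LHS]big_seq_cond [RHS]big_seq_cond.
apply: eq_bigr => d /andP[]; rewrite -dvdn_divisors // => dm dneq.
have d0 : (0 < d)%N by apply: dvdn_gt0 dm.
have dltm : (d <= m)%N by rewrite -ltnS ltn_neqAle dneq dvdn_leq.
have dn : (d <= n)%N := leq_trans dltm mn.
by rewrite (IH d k) ?d0 ?(IH d m) ?d0 // (leq_trans dltm).
Qed.

Lemma dconv_dinv f n : f 1%N != 0 -> (0 < n)%N ->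
  dconv (dinv f) f n = (n == 1%N)%:R.
Proof.
move=> f1 n0; rewrite /dconv (bigD1_seq n) ?divisors_uniq ?divisors_id //=.
rewrite divnn n0 mulrC -{1}(prednK n0) /dinv /= prednK // mulVKf //.
rewrite -[X in _ = X]addr0 -addrA; congr (_ + _).
apply/eqP; rewrite addrC subr_eq0; apply/eqP.
rewrite [LHS]big_seq_cond [RHS]big_seq_cond.
apply: eq_bigr => d /andP[]; rewrite -dvdn_divisors // => dm dneq.
have d0 : (0 < d)%N by apply: dvdn_gt0 dm.
have dn : (d < n)%N by rewrite ltn_neqAle dneq dvdn_leq.
by rewrite (@dinv_rec_fuel _ n.-1) // d0 -ltnS prednK.
Qed.

(* Coefficients of the formal Dirichlet series C(s), S(s) and R(s); the
   coefficient of n^-s in the sum of |rho|^-s over the normalised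
   compositions rho is the number of those of size n. The first two series
   diverge for every s, so identities between them are formal. *)
Definition Cseq (n : nat) : rat := 2%:R ^+ n.-1.
Definition Sseq (n : nat) : rat := 2%:R ^+ n./2.
Definition Rseq (n : nat) : rat := (num_normalised n)%:R.

(* Main.v *)
(* A composition of n is read as a binary word of length n - 1 recording, at
   each of the n - 1 junctions, whether there is a cut.  Extended n-periodically
   off the multiples of n, the word of a o b equals that of a (rescaled) at the
   multiples of |b| and is |b|-periodic elsewhere, so the factorisations of w
   correspond to the divisors d of n such that w is d-periodic off the multiples
   of d.  By the Chinese remainder theorem these divisors form a sublattice, and
   w is constant between the gcd and the lcm of two incomparable ones.  This
   rigidity yields that w is normalised iff all its irreducible factors are
   lexicographic minimal, and that the Moebius function mu of the lattice of
   right factors is the classical one on constant words, -1 on the other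
   irreducible words and 0 elsewhere.  For each of the three classes "all",
   "symmetric" and "normalised", which are closed under products and factors, the series of mu
   over the class is therefore the Dirichlet inverse of the counting series.
   Since exactly one of w and its reversal is minimal unless w is symmetric,
   2 / R = 1 / C + 1 / S. *)
Require Import Defs.
From mathcomp Require Import all_boot all_order all_algebra finmap.
From mathcomp Require Import boolp classical_sets cardinality.
From mathcomp Require Import zify.
Set Implicit Arguments.
Unset Strict Implicit.
Unset Printing Implicit Defensive.
Import GRing.Theory.

(** Bezout gives [u * d = v * e + gcdn d e]. If [j - i] is [t] times the gcd, then [i + t * u * d]
    equals [t * v * e + j]. *)
Lemma chinese_gcd d e i j : 0 < d -> 0 < e -> i = j %[mod gcdn d e] ->
  exists2 k, k = i %[mod d] & k = j %[mod e].
Proof.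
move=> + +; wlog: d e i j / i <= j => [H|ij] d0 e0 eij.
  case/orP: (leq_total i j) => h; first exact: H.
  have [] := H e d j i h e0 d0; first by rewrite gcdnC.
  by move=> k k1 k2; exists k.
have /dvdnP[t jE] : gcdn d e %| j - i by rewrite -eqn_mod_dvd //; exact/eqP.
case: (egcdnP e d0) => u v uE _.
exists (i + t * u * d); first by rewrite addnC modnMDl.
have -> : i + t * u * d = t * v * e + j.
  by rewrite -mulnA uE mulnDr -jE mulnA -(subnKC ij); lia.
by rewrite modnMDl.
Qed.

(** * The lattice of right factors of a binary word *)

Section Words.

Implicit Types (u v w : seq bool) (d e n : nat).

(** The size of the encoded composition, one more than its number of junctions. *)
Definition wlen w := (size w).+1.

(* Letters are numbered from 1; the value at multiples of wlen w is junk. *)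
Definition cyc w i := nth false w (i %% wlen w).-1.

(* w has a right factor of length d. *)
Definition splits w d := (d %| wlen w) &&
  all (fun i => (d %| i) || (cyc w i == cyc w (i %% d))) (iota 0 (wlen w)).

Lemma cyc_mod w i : cyc w (i %% wlen w) = cyc w i.
Proof. by rewrite /cyc modn_mod. Qed.

Lemma eq_dvdn_mod d i j : i = j %[mod d] -> (d %| i) = (d %| j).
Proof. by rewrite /dvdn => ->. Qed.

(** The boolean test covers a single period. Since [d] divides [wlen w], reducing modulo [wlen w]
    preserves classes modulo [d], so periodicity extends to all positions. *)
Lemma splitsP w d : reflect
  (d %| wlen w /\
   forall i j, i = j %[mod d] -> ~~ (d %| i) -> cyc w i = cyc w j)
  (splits w d).
Proof.
apply: (iffP andP) => -[dw H]; split => //; last first.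
  apply/allP => i _; case: (boolP (d %| i)) => //= di.
  by apply/eqP; apply: H => //; rewrite modn_mod.
suff E k : ~~ (d %| k) -> cyc w k = cyc w (k %% d).
  by move=> i j ij di; rewrite E // ij -E // -(eq_dvdn_mod ij).
move=> dk; have kk : k = k %% wlen w %[mod d] by rewrite modn_dvdm.
move/allP: H => /(_ (k %% wlen w)).
rewrite mem_iota add0n ltn_pmod // => /(_ isT).
by rewrite -(eq_dvdn_mod kk) (negPf dk) /= cyc_mod -kk => /eqP.
Qed.

Lemma splits_dvd w d : splits w d -> d %| wlen w.
Proof. by case/andP. Qed.

Lemma splits_gt0 w d : splits w d -> 0 < d.
Proof. by move/splits_dvd/dvdn_gt0; apply. Qed.

Lemma splits_eq w d i j :
  splits w d -> i = j %[mod d] -> ~~ (d %| i) -> cyc w i = cyc w j.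
Proof. by case/splitsP => _; apply. Qed.

Lemma splits1 w : splits w 1.
Proof. by apply/splitsP; split=> // i j; rewrite !dvd1n. Qed.

Lemma splits_wlen w : splits w (wlen w).
Proof. by apply/splitsP; split=> // i j ij _; rewrite /cyc ij. Qed.

(** Some [k] is congruent to [i] modulo [d] and to [j] modulo [e]. Since the gcd divides neither [i]
    nor [j], both periodicities apply and link [i] to [j] through [k]. *)
Lemma splits_gcd w d e : splits w d -> splits w e -> splits w (gcdn d e).
Proof.
move=> sd se; apply/splitsP; split.
  by rewrite (dvdn_trans (dvdn_gcdl _ _)) // splits_dvd.
move=> i j ij gi.
have [k ki kj] := chinese_gcd (splits_gt0 sd) (splits_gt0 se) ij.
have di : ~~ (d %| i) by apply: contra gi; apply: dvdn_trans; exact: dvdn_gcdl.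
have ej : ~~ (e %| j).
  by rewrite (eq_dvdn_mod ij) in gi; apply: contra gi; apply: dvdn_trans;
    exact: dvdn_gcdr.
by rewrite (splits_eq sd (esym ki) di) (splits_eq se (esym kj) ej).
Qed.

(** A position off the multiples of the lcm is off those of [d] or of [e], and that period alone
    suffices. *)
Lemma splits_lcm w d e : splits w d -> splits w e -> splits w (lcmn d e).
Proof.
move=> sd se; apply/splitsP; split; first by rewrite dvdn_lcm !splits_dvd.
move=> i j /eqP ij; rewrite dvdn_lcm negb_and => /orP[] ni.
  apply: (splits_eq sd) => //; rewrite -(modn_dvdm i (dvdn_lcml d e)).
  by rewrite (eqP ij) modn_dvdm // dvdn_lcml.
apply: (splits_eq se) => //; rewrite -(modn_dvdm i (dvdn_lcmr d e)).
by rewrite (eqP ij) modn_dvdm // dvdn_lcmr.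
Qed.

(* For i off the multiples of d and j off the multiples of e, a common
   representative of i mod d and j mod e links cyc w i to cyc w j. *)
Lemma splits_incomparable w d e i j : splits w d -> splits w e ->
  ~~ (d %| e) -> ~~ (e %| d) ->
  gcdn d e %| i -> gcdn d e %| j -> ~~ (lcmn d e %| i) -> ~~ (lcmn d e %| j) ->
  cyc w i = cyc w j.
Proof.
move=> sd se de ed.
have L x y : gcdn d e %| x -> gcdn d e %| y -> ~~ (d %| x) -> ~~ (e %| y) ->
    cyc w x = cyc w y.
  move=> gx gy dx ey.
  have xy : x = y %[mod gcdn d e] by rewrite (eqP gx) (eqP gy).
  have [k ki kj] := chinese_gcd (splits_gt0 sd) (splits_gt0 se) xy.
  by rewrite (splits_eq sd (esym ki) dx) (splits_eq se (esym kj) ey).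
move=> gi gj; rewrite !dvdn_lcm !negb_and => /orP[di|ei] /orP[dj|ej].
(* When [i] and [j] are both off the multiples of [d], each is compared with [d], which is off the
   multiples of [e]. The last case exchanges the roles of [d] and [e]. *)
- by rewrite (L i d) ?dvdn_gcdl // (L j d) ?dvdn_gcdl.
- exact: L.
- by apply/esym/L.
- by rewrite -(L e i) ?dvdn_gcdr // -(L e j) ?dvdn_gcdr.
Qed.

(* The factor of w delimited by its right factors of lengths d and e. *)
Definition subw w d e := mkseq (fun i => cyc w (d * i.+1)) (e %/ d).-1.

Lemma wlen_subw w d e : 0 < e -> d %| e -> wlen (subw w d e) = e %/ d.
Proof.
move=> e0 de; rewrite /wlen size_mkseq prednK // divn_gt0 ?(dvdn_gt0 e0) //.
exact: dvdn_leq.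
Qed.

Lemma cyc_subw w d e i : splits w e -> d %| e -> ~~ (e %/ d %| i) ->
  cyc (subw w d e) i = cyc w (d * i).
Proof.
move=> se de ni; have e0 := splits_gt0 se; have d0 := dvdn_gt0 e0 de.
rewrite {1}/cyc wlen_subw //.
have c0 : 0 < e %/ d by rewrite divn_gt0 // dvdn_leq.
have r0 : 0 < i %% (e %/ d) by rewrite lt0n.
rewrite nth_mkseq; last by have := ltn_pmod i c0; lia.
rewrite prednK // muln_modr [d * (e %/ d)]mulnC divnK //.
apply: (splits_eq se); first by rewrite modn_mod.
by rewrite (eq_dvdn_mod (modn_mod _ _)) -(divnK de) mulnC dvdn_pmul2l.
Qed.

(** Multiplication by [d] identifies the lattice of [subw w d e] with the interval from [d] to [e]
    in the lattice of [w]. Periodicity modulo [d * c] comes from [d] off the multiples of [d], and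
    from the factor on them. *)
Lemma splits_subw w d e c : splits w d -> splits w e -> d %| e ->
  splits (subw w d e) c = (d * c %| e) && splits w (d * c).
Proof.
move=> sd se de; have e0 := splits_gt0 se; have d0 := splits_gt0 sd.
have E : (d * c %| e) = (c %| e %/ d) by rewrite -{1}(divnK de) mulnC dvdn_pmul2r.
apply/idP/andP => [sc|[dce sdc]].
  have := splits_dvd sc; rewrite wlen_subw // => ce; rewrite E; split=> //.
  apply/splitsP; split.
    by rewrite (dvdn_trans _ (splits_dvd se)) // E.
  move=> i j ij; case: (boolP (d %| i)) => di; last first.
    move=> _; apply: (splits_eq sd) => //.
    by rewrite -(modn_dvdm i (dvdn_mulr c (dvdnn d))) ij modn_dvdm ?dvdn_mulr.
  have dj : d %| j.
    rewrite -(eq_dvdn_mod (d := d) (i := i)) //.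
    by rewrite -(modn_dvdm i (dvdn_mulr c (dvdnn d))) ij modn_dvdm ?dvdn_mulr.
  case/dvdnP: di ij => i' ->; case/dvdnP: dj => j' ->.
  rewrite ![_ * d]mulnC -!muln_modr => /eqP; rewrite eqn_pmul2l // => /eqP ij.
  rewrite dvdn_pmul2l // => ci.
  have N k : ~~ (c %| k) -> ~~ (e %/ d %| k).
    by apply: contra; apply: dvdn_trans.
  rewrite -!(cyc_subw se de) ?N //; last by rewrite -(eq_dvdn_mod ij).
  exact: (splits_eq sc).
apply/splitsP; rewrite wlen_subw // -E; split=> // i j ij ci.
rewrite E in dce.
have N k : ~~ (c %| k) -> ~~ (e %/ d %| k).
  by apply: contra; apply: dvdn_trans.
rewrite !cyc_subw ?N //; last by rewrite -(eq_dvdn_mod ij).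
by apply: (splits_eq sdc); rewrite -?muln_modr ?ij // dvdn_pmul2l.
Qed.

Lemma subw_subw w d e a b : splits w e -> d %| e -> 0 < b -> a %| b ->
  b %| e %/ d -> subw (subw w d e) a b = subw w (d * a) (d * b).
Proof.
move=> se de b0 ab be; have e0 := splits_gt0 se; have d0 := dvdn_gt0 e0 de.
rewrite /subw divnMl //; apply/eq_in_map => i.
rewrite mem_iota add0n /= => ib; rewrite cyc_subw ?mulnA //.
have c0 : 0 < e %/ d by rewrite divn_gt0 // dvdn_leq.
have a0 := dvdn_gt0 b0 ab.
(* Only positions below [b], hence below [e %/ d], are read, so the junk values are avoided. *)
have H : a * i.+1 < b.
  by rewrite -(divnK ab) mulnC ltn_pmul2r //; lia.
rewrite gtnNdvd ?muln_gt0 ?a0 //; exact: leq_trans H (dvdn_leq c0 be).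
Qed.

Lemma eq_word u v : wlen u = wlen v ->
  (forall i, ~~ (wlen u %| i) -> cyc u i = cyc v i) -> u = v.
Proof.
move=> uv H; apply: (@eq_from_nth _ false); first by case: uv.
move=> i iu; have := H i.+1; rewrite /cyc -uv !modn_small ?ltnS //=; apply.
by rewrite gtnNdvd.
Qed.

Lemma subw_full w : subw w 1 (wlen w) = w.
Proof.
apply: eq_word => [|i]; first by rewrite wlen_subw ?divn1.
rewrite wlen_subw // divn1 => ni.
by rewrite cyc_subw ?divn1 ?mul1n ?splits_wlen.
Qed.

(** * Constant and prime words *)

Definition constw w := w == nseq (size w) (head false w).

Lemma constwP w : reflect
  (forall i j, ~~ (wlen w %| i) -> ~~ (wlen w %| j) -> cyc w i = cyc w j)
  (constw w).
Proof.
apply: (iffP eqP) => [-> i j|H]; rewrite /cyc /wlen ?size_nseq.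
  by have L k : ~~ ((size w).+1 %| k) -> (k %% (size w).+1).-1 < size w;
    [have := ltn_pmod k (ltn0Sn (size w)); rewrite /dvdn; lia|];
    move=> /L hi /L hj; rewrite !nth_nseq hi hj.
apply: (@eq_from_nth _ false); rewrite ?size_nseq // => i iw.
rewrite nth_nseq iw -nth0.
have := H i.+1 1; rewrite /cyc /wlen !modn_small //=; last by case: (w) iw.
by apply; rewrite gtnNdvd //; lia.
Qed.

(** Constant words of prime size and the empty word qualify too, so case analyses test [constw]
    first. *)
Definition primew w :=
  all (fun d => splits w d ==> (d == 1) || (d == wlen w)) (divisors (wlen w)).

Lemma primewP w : reflect
  (forall d, splits w d -> d = 1 \/ d = wlen w) (primew w).
Proof.
apply: (iffP allP) => H d.
  move=> sd; have := H d; rewrite -dvdn_divisors // splits_dvd // => /(_ isT).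
  by rewrite sd => /orP[] /eqP; auto.
by move=> _; apply/implyP => /H [] ->; rewrite eqxx ?orbT.
Qed.

Lemma splits_constw w d : constw w -> d %| wlen w -> splits w d.
Proof.
move=> /constwP cw dw; apply/splitsP; split=> // i j ij di.
have N k : ~~ (d %| k) -> ~~ (wlen w %| k).
  by apply: contra; apply: dvdn_trans.
by apply: cw; apply: N; rewrite // -(eq_dvdn_mod ij).
Qed.

Lemma constw_subw w d e : splits w e -> d %| e ->
  (forall i j, d %| i -> d %| j -> ~~ (e %| i) -> ~~ (e %| j) ->
     cyc w i = cyc w j) -> constw (subw w d e).
Proof.
move=> se de H; have e0 := splits_gt0 se; have d0 := dvdn_gt0 e0 de.
apply/constwP => i j; rewrite wlen_subw // => ni nj; rewrite !cyc_subw //.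
have E k : (e %| d * k) = (e %/ d %| k).
  by rewrite -{1}(divnK de) mulnC dvdn_pmul2l.
by apply: H; rewrite ?E // dvdn_mulr.
Qed.

Lemma subw_constw w d e : splits w e -> d %| e -> constw w ->
  constw (subw w d e).
Proof.
move=> se de /constwP cw; apply: constw_subw => // i j _ _ ni nj.
by apply: cw; [apply: contra ni|apply: contra nj];
  apply: dvdn_trans; exact: splits_dvd.
Qed.

End Words.

(** * Compositions as binary words *)

Section Compositions.

Implicit Types (u v w : seq bool) (d e n : nat).

(* The word lists the junctions from left to right, true being a cut. *)
Fixpoint dec w : seq nat :=
  if w is x :: w' then
    if x then 1 :: dec w' else (head 0 (dec w')).+1 :: behead (dec w')
  else [:: 1].

Lemma dec_cons w : exists x s, dec w = x.+1 :: s.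
Proof. by case: w => [|[] w] /=; [exists 0, [::]|exists 0, (dec w)|eauto]. Qed.

Lemma is_composition_dec w : is_composition (dec w).
Proof.
apply/andP; split; first by have [x [s ->]] := dec_cons w.
by elim: w => [|[] w IH] //=; case: (dec w) IH => //= y s /andP[].
Qed.

Lemma sumn_dec w : sumn (dec w) = wlen w.
Proof.
rewrite /wlen; elim: w => [|[] w IH] //=; first by rewrite IH.
by have [x [s E]] := dec_cons w; rewrite E /= in IH *; rewrite -IH.
Qed.

Lemma dec_inj : injective dec.
Proof.
elim=> [|x u IH] [|y v] //=.
- by case: y => //; have [x [s ->]] := dec_cons v.
- by case: x => //; have [x [s ->]] := dec_cons u.
have [a [s Ea]] := dec_cons u; have [b [t Eb]] := dec_cons v.
case: x; case: y; rewrite ?Ea ?Eb //= => -[].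
  by move=> ab st; rewrite (IH v) // Ea Eb ab st.
by move=> ab st; rewrite (IH v) // Ea Eb ab st.
Qed.

Lemma dec_surj a : is_composition a -> exists w, a = dec w.
Proof.
case/andP; elim: a => // -[|k] a IH _ //= pa.
elim: k => [|k [w wE]]; last by exists (false :: w); rewrite /= -wE.
case: a IH pa => [|y a] IH pa; first by exists [::].
by have [w ->] := IH isT pa; exists (true :: w).
Qed.

Lemma dec_catT u v : dec (u ++ true :: v) = dec u ++ dec v.
Proof.
elim: u => [|[] u IH] //=; rewrite IH //.
by have [x [s ->]] := dec_cons u.
Qed.

Lemma dec_catF u v : dec (u ++ false :: v) = near_cat (dec u) (dec v).
Proof.
have [y [t Ev]] := dec_cons v.
elim: u => [|[] u IH] /=; rewrite ?IH Ev //.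
  by have [x [s ->]] := dec_cons u.
by have [x [s ->]] := dec_cons u; case: s.
Qed.

Lemma rev_near_cat a b : a != [::] -> b != [::] ->
  rev (near_cat a b) = near_cat (rev b) (rev a).
Proof.
have cat_near x s t : near_cat (rcons s x) t = s ++ near_cat [:: x] t.
  elim: s => //= y s ->; case: t => [|z t] /=; last by case: s.
  by rewrite cats1; case: s.
have near_rcons s t x : t != [::] ->
    near_cat s (rcons t x) = rcons (near_cat s t) x.
  case: t => // y t _; elim: s => // z s IH.
  by case: s IH => //= z' s ->.
elim: a => // x a IH _ b0; case: a IH => [|z a] IH.
  case: b b0 {IH} => // y b _ /=; rewrite !rev_cons cat_near /= -cats1.
  by rewrite addnC.
have -> : near_cat (x :: z :: a) b = x :: near_cat (z :: a) b.
  by case: (b) b0.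
rewrite (rev_cons x (near_cat _ _)) IH // (rev_cons x) near_rcons //.
by rewrite -size_eq0 size_rev.
Qed.

Lemma dec_rev w : dec (rev w) = rev (dec w).
Proof.
elim: w => [|x w IH] //; rewrite rev_cons -cats1; case: x.
  by rewrite dec_catT IH /= rev_cons cats1.
have -> : dec (false :: w) = near_cat [:: 1] (dec w).
  by have [x [s E]] := dec_cons w; rewrite /= E.
have [x [s E]] := dec_cons w.
by rewrite dec_catF IH rev_near_cat // E.
Qed.

Lemma size1_dec w : (size (dec w) == 1) = all negb w.
Proof.
elim: w => [|[] w IH] //=; have [x [s E]] := dec_cons w; rewrite E //.
by rewrite -IH E.
Qed.

Lemma all1_dec w : all (pred1 1) (dec w) = all id w.
Proof. by elim: w => [|[] w IH] //=; have [x [s ->]] := dec_cons w. Qed.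

Lemma eq1_dec w : (dec w == [:: 1]) = (w == [::]).
Proof. by rewrite (inj_eq dec_inj w [::]). Qed.

(** Copies of [v] separated by the letters of [u]: a cut where consecutive copies are concatenated,
    no cut where they are near concatenated. *)
Definition wcomp u v := v ++ flatten [seq x :: v | x <- u].

Lemma wcomp_cons x u v : wcomp (x :: u) v = v ++ x :: wcomp u v.
Proof. by []. Qed.

Lemma wcomp0s v : wcomp [::] v = v.
Proof. exact: cats0. Qed.

Lemma wcomps0 u : wcomp u [::] = u.
Proof. by elim: u => // x u IH; rewrite wcomp_cons IH. Qed.

Lemma wcomp_cat x u v w : wcomp (u ++ x :: v) w = wcomp u w ++ x :: wcomp v w.
Proof.
elim: u => [|y u IH]; first by rewrite wcomp0s wcomp_cons.
by rewrite cat_cons !wcomp_cons IH -catA.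
Qed.

Lemma wcompA u v w : wcomp (wcomp u v) w = wcomp u (wcomp v w).
Proof.
elim: u => [|x u IH]; first by rewrite !wcomp0s.
by rewrite !wcomp_cons wcomp_cat IH.
Qed.

Lemma compo_dec u v : compo (dec u) (dec v) = dec (wcomp u v).
Proof.
have near_cat0 a : near_cat a [::] = a by case: a => [|? []].
have near_pow0 k : near_pow (dec v) k.+1 != [::].
  have [x [s E]] := dec_cons v; rewrite /near_pow /= E.
  by case: (iter k _ _) => [|??]; case: s {E}.
have near_catA a b c : b != [::] -> near_cat a b ++ c = near_cat a (b ++ c).
  case: b => // y b _; elim: a => // x a IH.
  by case: a IH => [|z a] IH //;
    rewrite -[LHS]/(x :: (near_cat (z :: a) (y :: b) ++ c)) IH.
elim: u => [|x u IH].
  by rewrite /compo /= cats0 near_cat0 wcomp0s.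
rewrite wcomp_cons; case: x.
  by rewrite dec_catT -IH /compo /= near_cat0.
rewrite dec_catF -IH /compo.
have [x [s E]] := dec_cons u; rewrite [dec (_ :: u)]/= E !map_cons /=.
by rewrite -near_catA //; exact: near_pow0.
Qed.

Lemma foldr_compo_dec ws :
  foldr compo [:: 1] (map dec ws) = dec (foldr wcomp [::] ws).
Proof. by elim: ws => //= w ws ->; rewrite compo_dec. Qed.

Lemma wlen_wcomp u v : wlen (wcomp u v) = wlen u * wlen v.
Proof.
rewrite /wlen; elim: u => [|x u IH]; first by rewrite wcomp0s mul1n.
by rewrite wcomp_cons size_cat /= IH mulSn.
Qed.

Lemma all_wcomp (P : pred bool) u v : all P (wcomp u v) = all P u && all P v.
Proof.
elim: u => [|x u IH]; first by rewrite wcomp0s.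
by rewrite wcomp_cons all_cat /= IH; case: (all P v); case: (P x); case: (all P u).
Qed.

Lemma nth_wcomp u v k : k < size (wcomp u v) -> nth false (wcomp u v) k =
  if wlen v %| k.+1 then nth false u (k.+1 %/ wlen v).-1
  else nth false v (k.+1 %% wlen v).-1.
Proof.
elim: u k => [|x u IH] k.
  rewrite wcomp0s => kv; have kv' : k.+1 < wlen v by [].
  by rewrite gtnNdvd // modn_small.
rewrite wcomp_cons size_cat nth_cat /=; case: (ltnP k (size v)) => kv.
  move=> _; have kv' : k.+1 < wlen v by [].
  by rewrite gtnNdvd // modn_small.
move=> kl; have [k' kE] : exists k', k = k' + size v.
  by exists (k - size v); rewrite subnK.
rewrite {kv}kE in kl *; rewrite addnK; case: k' kl => [|k'] kl /=.
  by rewrite add0n -/(wlen v) dvdnn divnn.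
rewrite addSn; have -> : (k' + size v).+2 = wlen v + k'.+1 by rewrite /wlen; lia.
rewrite IH; last by move: kl; rewrite addSn addnC addnS ltnS ltn_add2l.
rewrite dvdn_addr // modnDl divnDl // divnn /=.
case: ifP => // dk.
have : 0 < k'.+1 %/ wlen v by rewrite divn_gt0 // dvdn_leq.
by case: (k'.+1 %/ wlen v).
Qed.

Lemma cyc_wcomp u v i : ~~ (wlen (wcomp u v) %| i) -> cyc (wcomp u v) i =
  if wlen v %| i then cyc u (i %/ wlen v) else cyc v i.
Proof.
move=> ni; have r0 : 0 < i %% wlen (wcomp u v) by rewrite lt0n.
rewrite {1}/cyc nth_wcomp; last first.
  by move: r0; rewrite /wlen; have := ltn_pmod i (ltn0Sn (size (wcomp u v))); lia.
rewrite prednK // /cyc wlen_wcomp.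
rewrite modn_dvdm ?dvdn_mull // (eq_dvdn_mod (j := i)); last first.
  by rewrite modn_dvdm // dvdn_mull.
by rewrite modn_divl.
Qed.

Lemma splits_wcomp u v : splits (wcomp u v) (wlen v).
Proof.
apply/splitsP; rewrite wlen_wcomp dvdn_mull //; split=> // i j ij vi.
have vj : ~~ (wlen v %| j) by rewrite -(eq_dvdn_mod ij).
have N k : ~~ (wlen v %| k) -> ~~ (wlen (wcomp u v) %| k).
  by apply: contra; apply: dvdn_trans; rewrite wlen_wcomp dvdn_mull.
by rewrite !cyc_wcomp ?N // (negPf vi) (negPf vj) /cyc ij.
Qed.

Lemma subw_wcompr u v : subw (wcomp u v) 1 (wlen v) = v.
Proof.
apply: eq_word; first by rewrite wlen_subw ?divn1.
move=> i; rewrite wlen_subw // divn1 => vi.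
rewrite cyc_subw ?divn1 ?splits_wcomp // mul1n cyc_wcomp ?(negPf vi) //.
by apply: contra vi; apply: dvdn_trans; rewrite wlen_wcomp dvdn_mull.
Qed.

Lemma subw_wcompl u v :
  subw (wcomp u v) (wlen v) (wlen (wcomp u v)) = u.
Proof.
have E : wlen (wcomp u v) %/ wlen v = wlen u by rewrite wlen_wcomp mulnK.
have D : wlen v %| wlen (wcomp u v) by rewrite wlen_wcomp dvdn_mull.
apply: eq_word; first by rewrite wlen_subw.
move=> i; rewrite wlen_subw // E => ui.
rewrite cyc_subw ?splits_wlen ?E // cyc_wcomp.
  by rewrite dvdn_mulr // mulKn.
by rewrite wlen_wcomp mulnC dvdn_pmul2l.
Qed.

(** With [splits_wcomp], [subw_wcompr] and [subw_wcompl], this makes the factorisations of [w] into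
    two factors correspond to the [d] such that [splits w d]. *)
Lemma wcomp_subw w d : splits w d ->
  wcomp (subw w d (wlen w)) (subw w 1 d) = w.
Proof.
move=> sd; have d0 := splits_gt0 sd; have dw := splits_dvd sd.
have E : wlen (wcomp (subw w d (wlen w)) (subw w 1 d)) = wlen w.
  by rewrite wlen_wcomp !wlen_subw // divn1 divnK.
apply: eq_word => // i ni; rewrite cyc_wcomp //.
rewrite E in ni; rewrite wlen_subw // divn1; case: (boolP (d %| i)) => di.
  rewrite cyc_subw ?splits_wlen //; first by rewrite mulnC divnK.
  by apply: contra ni => ni; rewrite -(divnK di) -(divnK dw) dvdn_pmul2r.
by rewrite cyc_subw ?divn1 // mul1n.
Qed.

Lemma constw_all b w : all (pred1 b) w -> constw w.
Proof. by move/all_pred1P => E; rewrite /constw E size_nseq; case: (size w). Qed.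

Lemma constw_cases w : constw w -> all negb w \/ all id w.
Proof.
move=> /eqP ->; case: (head _ _); [right|left];
  by rewrite all_nseq orbT.
Qed.

Lemma all_negb_constw w : all negb w -> constw w.
Proof. by move=> H; apply: (@constw_all false); apply: sub_all H => -[]. Qed.

Lemma all_id_constw w : all id w -> constw w.
Proof. by move=> H; apply: (@constw_all true); apply: sub_all H => -[]. Qed.

(** * Irreducible and normalised words *)

Definition trivw u v :=
  [|| u == [::], v == [::], all negb u && all negb v | all id u && all id v].

Lemma trivial_fact_dec u v : trivial_fact (dec u) (dec v) = trivw u v.
Proof. by rewrite /trivial_fact /trivw !eq1_dec !size1_dec !all1_dec. Qed.

Definition irrw w := constw w || primew w.

Lemma wlen_eq1 w : (wlen w == 1) = (w == [::]).
Proof. by case: w. Qed.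

(** By [all_wcomp], the factors of a constant word are constant with the same letter, so its
    factorisations are trivial. For the same reason a trivial factorisation of a nonconstant word
    has an empty factor, which leaves only the right factors of lengths 1 and [wlen w]. *)
Lemma irrwP w : irrw w <-> only_trivial_facts (dec w).
Proof.
split=> [iw b c /dec_surj[u ->] /dec_surj[v ->]|ow].
  rewrite compo_dec => /dec_inj wE; rewrite trivial_fact_dec /trivw.
  case/orP: iw => [cw|/primewP pw].
    by case: (constw_cases cw); rewrite wE all_wcomp => ->; rewrite ?orbT.
  have := pw (wlen v); rewrite wE splits_wcomp => /(_ isT) [/eqP|/eqP].
    by rewrite wlen_eq1 => ->; rewrite orbT.
  by rewrite wlen_wcomp -{1}[wlen v]mul1n eqn_pmul2r // eq_sym wlen_eq1 => ->.
apply/orP; case: (boolP (constw w)) => cw; [by left|right].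
apply/primewP => d sd; have d0 := splits_gt0 sd; have dw := splits_dvd sd.
have := ow _ _ (is_composition_dec (subw w d (wlen w)))
  (is_composition_dec (subw w 1 d)).
rewrite compo_dec wcomp_subw // trivial_fact_dec => /(_ erefl) /or4P[].
- rewrite -wlen_eq1 wlen_subw // => /eqP q1; right.
  by rewrite -(divnK dw) q1 mul1n.
- by rewrite -wlen_eq1 wlen_subw // divn1 => /eqP; left.
- rewrite -all_wcomp wcomp_subw // => /all_negb_constw cw'.
  by rewrite cw' in cw.
- rewrite -all_wcomp wcomp_subw // => /all_id_constw cw'.
  by rewrite cw' in cw.
Qed.

Definition lexminw w := lex_minimal (dec w).

Lemma lexmin_constw w : constw w -> lexminw w.
Proof.
move=> cw; rewrite /lexminw /lex_minimal -dec_rev.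
suff -> : rev w = w by exact: Order.POrderTheory.lexx.
by rewrite (eqP cw) rev_nseq.
Qed.

(** Minimality is asked of every irreducible interval of the lattice rather than along one chosen
    factorisation, so that it passes to factors and, by [goodw_glue], to products. *)
Definition goodw w := forall d e, splits w d -> splits w e -> d %| e ->
  irrw (subw w d e) -> lexminw (subw w d e).

Lemma goodw_constw w : constw w -> goodw w.
Proof.
by move=> cw d e sd se de _; apply: lexmin_constw; apply: subw_constw.
Qed.

Lemma subw_id w d : subw w d d = [::].
Proof. by rewrite /subw divnn; case: d. Qed.

Lemma goodw_irr w : irrw w -> lexminw w -> goodw w.
Proof.
case/orP=> [cw _|/primewP pw lw]; first exact: goodw_constw.
move=> d e /pw[] -> /pw[] ->; rewrite ?subw_id ?subw_full //.
move/dvdn_leq => /(_ isT) wl.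
have -> : wlen w = 1 by move: wl; rewrite /wlen; lia.
by rewrite subw_id.
Qed.

Lemma goodw_subw w d e : splits w d -> splits w e -> d %| e ->
  goodw w -> goodw (subw w d e).
Proof.
move=> sd se de gw a b; rewrite !splits_subw // => /andP[da sa] /andP[db sb] ab.
have b0 : 0 < b by have := splits_gt0 sb; rewrite muln_gt0 => /andP[].
have d0 := splits_gt0 sd.
rewrite subw_subw //; first by apply: gw => //; rewrite dvdn_pmul2l.
by rewrite -(dvdn_pmul2r d0) divnK // mulnC.
Qed.

(* An irreducible factor of w that straddles the cut at d lies inside an
   interval between a gcd and an lcm of right factors, hence is constant. *)
Lemma goodw_glue w d : splits w d -> goodw (subw w 1 d) ->
  goodw (subw w d (wlen w)) -> goodw w.
Proof.
move=> sd gr gl p q sp sq pq irr.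
have d0 := splits_gt0 sd; have dw := splits_dvd sd.
have p0 := splits_gt0 sp; have q0 := splits_gt0 sq; have qw := splits_dvd sq.
have caser : q %| d -> lexminw (subw w p q).
  move=> qd; have pd := dvdn_trans pq qd.
  have E : subw (subw w 1 d) p q = subw w p q.
    by rewrite subw_subw ?divn1 // !mul1n.
  by rewrite -E; apply: gr; rewrite ?E // splits_subw ?splits1 // mul1n ?pd ?qd.
have casel : d %| p -> lexminw (subw w p q).
  move=> dp; have dq := dvdn_trans dp pq.
  have qd0 : 0 < q %/ d by rewrite divn_gt0 // dvdn_leq.
  have qwd : q %/ d %| wlen w %/ d by rewrite -(dvdn_pmul2r d0) !divnK.
  have pqd : p %/ d %| q %/ d by rewrite -(dvdn_pmul2r d0) !divnK.
  have E : subw (subw w d (wlen w)) (p %/ d) (q %/ d) = subw w p q.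
    rewrite (subw_subw (splits_wlen w) dw qd0 pqd qwd).
    by rewrite ![d * _]mulnC !divnK.
  rewrite -E; apply: gl; rewrite ?E // splits_subw ?splits_wlen //.
    by rewrite mulnC divnK // sp andbT splits_dvd.
  by rewrite mulnC divnK // sq andbT splits_dvd.
case/orP: irr => [/lexmin_constw //|/primewP prim].
(* This right factor lies between [p] and [q], so primality makes it one of them. If [m = p], the
   interval lies between the gcd and the lcm of [q] and [d]; if [m = q], between those of [p] and
   [d]. Comparable pairs fall under [caser] or [casel]. *)
pose m := gcdn q (lcmn p d).
have pm : p %| m by rewrite dvdn_gcd pq dvdn_lcml.
have sm : splits w m by apply: splits_gcd => //; apply: splits_lcm.
have := prim (m %/ p); rewrite splits_subw // wlen_subw //.
rewrite [p * _]mulnC divnK // dvdn_gcdl sm => /(_ isT) mE.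
have {mE prim} [] : m = p \/ m = q.
  by case: mE => mE; [left|right]; rewrite -(divnK pm) mE ?mul1n // divnK.
- move=> mE; case: (boolP (q %| d)) => qd; first exact: caser.
  have gp : gcdn q d %| p.
    by rewrite -mE dvdn_gcd dvdn_gcdl (dvdn_trans (dvdn_gcdr _ _)) ?dvdn_lcmr.
  case: (boolP (d %| q)) => dq.
    by apply: casel; rewrite (gcdn_idPr dq) in gp.
  apply: lexmin_constw; apply: constw_subw => // i j pi pj qi qj.
  apply: (splits_incomparable sq sd) => //; rewrite ?(dvdn_trans gp) //.
    by apply: contra qi; apply: dvdn_trans; rewrite dvdn_lcml.
  by apply: contra qj; apply: dvdn_trans; rewrite dvdn_lcml.
- move=> mE; case: (boolP (d %| p)) => dp; first exact: casel.
  have ql : q %| lcmn p d by rewrite -mE dvdn_gcdr.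
  case: (boolP (p %| d)) => pd.
    by apply: caser; rewrite (lcmn_idPr pd) in ql.
  apply: lexmin_constw; apply: constw_subw => // i j pi pj qi qj.
  apply: (splits_incomparable sp sd) => //;
    rewrite ?(dvdn_trans (dvdn_gcdl p d)) //.
    by apply: contra qi; apply: dvdn_trans.
  by apply: contra qj; apply: dvdn_trans.
Qed.

Lemma goodw_wcomp u v : goodw (wcomp u v) <-> goodw u /\ goodw v.
Proof.
split=> [g|[gu gv]].
  have suv := splits_wcomp u v; split.
    rewrite -(subw_wcompl u v).
    by apply: goodw_subw; rewrite ?splits_wlen // splits_dvd.
  by rewrite -(subw_wcompr u v); apply: goodw_subw; rewrite ?splits1.
by apply: (goodw_glue (splits_wcomp u v)); rewrite ?subw_wcompr ?subw_wcompl.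
Qed.

Lemma irrw_factors w : exists2 ws, all irrw ws & foldr wcomp [::] ws = w.
Proof.
have [n] := ubnP (size w); elim: n w => // n IH w wn.
case: (boolP (irrw w)) => [iw|].
  by exists [:: w]; rewrite /= ?iw // wcomps0.
rewrite negb_or => /andP[_ /allPn[d _]].
rewrite negb_imply => /andP[sd]; rewrite negb_or => /andP[d1 dw].
have d0 := splits_gt0 sd; have dvw := splits_dvd sd.
have dlt : d < wlen w by rewrite ltn_neqAle dw dvdn_leq.
have q1 : 1 < d by rewrite ltn_neqAle eq_sym d1.
have q2 : wlen w %/ d < wlen w by rewrite ltn_Pdiv.
have [|us us_irr usE] := IH (subw w d (wlen w)).
  by have := wlen_subw w (isT : 0 < wlen w) dvw; move: q2 wn; rewrite /wlen; lia.
have [|vs vs_irr vsE] := IH (subw w 1 d).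
  have := wlen_subw w d0 (dvd1n d); rewrite divn1.
  by move: dlt wn; rewrite /wlen; lia.
exists (us ++ vs); first by rewrite all_cat us_irr.
rewrite foldr_cat vsE -[RHS](wcomp_subw sd) -usE.
elim: us {us_irr usE} => [|u us IHs] /=; first by rewrite wcomp0s.
by rewrite IHs wcompA.
Qed.

(** Turns any list of irreducible factors into one without adjacent trivial pairs, as
    [irreducible_fact] demands: from right to left, empty words are dropped and other trivial pairs
    are replaced by their product. *)
Lemma merge_trivial (P : pred (seq bool)) ws :
  (forall u v, u != [::] -> v != [::] -> trivw u v -> P (wcomp u v)) ->
  ws != [::] -> all P ws ->
  exists ws', [/\ ws' != [::], all P ws',
    foldr wcomp [::] ws' = foldr wcomp [::] ws
    & sorted (fun u v => ~~ trivw u v) ws'].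
Proof.
move=> PM; elim: ws => // b ws IH _ /= /andP[Pb Pws].
case: (eqVneq ws [::]) => [->|ws0]; first by exists [:: b]; rewrite /= Pb.
have [[|c fs] [//= _ Pcfs <- srt]] := IH ws0 Pws.
case/andP: Pcfs => Pc Pfs.
case: (boolP (trivw b c)) => bc; last first.
  by exists [:: b, c & fs]; rewrite /= Pb Pc Pfs bc.
case: (eqVneq b [::]) => [->|b0].
  by exists (c :: fs); rewrite /= Pc Pfs wcomp0s.
case: (eqVneq c [::]) => [c0|c0].
  (* An empty [c] would form a trivial pair with a successor, so [fs] is empty. *)
  rewrite c0 in srt *; case: fs srt Pfs => [|f fs] //= _ _.
  by exists [:: b]; rewrite /= Pb wcomp0s.
exists (wcomp b c :: fs); split=> //=; first by rewrite PM.
  exact: wcompA.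
case: fs srt {Pfs} => //= f fs /andP[cf ->]; rewrite andbT.
(* If the merged word formed a trivial pair with [f], then so would [c] already. *)
apply: contra cf; rewrite /trivw !all_wcomp -wlen_eq1 wlen_wcomp muln_eq1.
rewrite !wlen_eq1 (negPf b0) /= => /or3P[->|/andP[/andP[_ ->] ->]|/andP[/andP[_ ->] ->]];
  by rewrite ?orbT.
Qed.

Lemma normalised_dec w : normalised (dec w) <-> goodw w.
Proof.
split=> [[fs [_ cfs wE _ ifs] lfs]|gw].
  suff [w' w'E gw'] : exists2 w', foldr compo [:: 1] fs = dec w' & goodw w'.
    by rewrite w'E in wE; rewrite (dec_inj wE).
  elim: fs {wE} cfs ifs lfs => [|f fs IH] /=.
    by move=> _ _ _; exists [::] => //; exact: goodw_constw.
  case/andP=> /dec_surj[u ->] cfs ifs /andP[lu lfs].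
  have [|w' -> gw'] := IH cfs _ lfs.
    by move=> b bfs; apply: ifs; rewrite inE bfs orbT.
  rewrite compo_dec; exists (wcomp u w') => //; apply/goodw_wcomp; split=> //.
  by apply: goodw_irr => //; apply/irrwP/ifs; rewrite inE eqxx.
have [ws iws wsE] := irrw_factors w.
have lws : all (predI irrw lexminw) ws.
  elim: ws w gw iws wsE => //= v ws IH w gw /andP[iv iws] wE.
  rewrite -wE in gw; case/goodw_wcomp: gw => gv gws.
  rewrite iv (IH _ gws) // andbT; have := gv 1 (wlen v).
  by rewrite subw_full; apply; rewrite ?splits1 ?splits_wlen.
have [||//|ws' [ws0 Pws E srt]] := @merge_trivial (predI irrw lexminw)
    (* A factorisation has to be a nonempty list, so the empty product becomes the one-element list
       of the empty word. *)
    (if ws is [::] then [:: [::]] else ws).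
- move=> u v u0 v0; rewrite /trivw (negPf u0) (negPf v0) /= -!all_wcomp => c.
  have cw : constw (wcomp u v).
    by case/orP: c => [/all_negb_constw|/all_id_constw].
  by rewrite /irrw cw lexmin_constw.
- by case: (ws).
- by case: (ws) lws.
have {}E : foldr wcomp [::] ws' = w by rewrite E -wsE; case: (ws).
exists (map dec ws'); last first.
  by rewrite all_map; apply: sub_all Pws => v /andP[].
split.
- by case: (ws') ws0.
- by rewrite all_map; apply/allP => v _; exact: is_composition_dec.
- by rewrite foldr_compo_dec E.
- rewrite sorted_map; apply: sub_sorted srt => u v /=.
  by rewrite trivial_fact_dec.
- move=> b /mapP[v vw ->]; apply/irrwP.
  by have /andP[] := allP Pws v vw.
Qed.

End Compositions.

(** * Counting by Moebius inversion *)

Section Reversal.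

Implicit Types (u v w : seq bool) (d : nat).

Lemma wcomp_inj u v u' v' : wlen v = wlen v' ->
  wcomp u v = wcomp u' v' -> u = u' /\ v = v'.
Proof.
move=> vv E; have := subw_wcompl u v; have := subw_wcompr u v.
by rewrite E vv subw_wcompl subw_wcompr => -> ->.
Qed.

Lemma wlen_rev w : wlen (rev w) = wlen w.
Proof. by rewrite /wlen size_rev. Qed.

Lemma rev_wcomp u v : rev (wcomp u v) = wcomp (rev u) (rev v).
Proof.
elim: u => [|x u IH]; first by rewrite !wcomp0s.
by rewrite wcomp_cons rev_cat rev_cons IH -cats1 -catA rev_cons -cats1
  wcomp_cat wcomp0s.
Qed.

Lemma splits_rev w d : splits (rev w) d = splits w d.
Proof.
suff H v : splits v d -> splits (rev v) d.
  by apply/idP/idP => /H; rewrite ?revK.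
move=> sd; rewrite -(wcomp_subw sd) rev_wcomp.
have := splits_wcomp (rev (subw v d (wlen v))) (rev (subw v 1 d)).
by rewrite wlen_rev wlen_subw ?divn1 // (splits_gt0 sd).
Qed.

Lemma primew_rev w : primew (rev w) = primew w.
Proof.
by rewrite /primew wlen_rev; apply: eq_all => d; rewrite splits_rev.
Qed.

Lemma constw_rev w : constw (rev w) = constw w.
Proof.
suff H v : constw v -> constw (rev v).
  by apply/idP/idP => /H; rewrite ?revK.
by move=> cv; rewrite (eqP cv) rev_nseq -(eqP cv).
Qed.

Lemma lexminw_rev w :
  (lexminw w + lexminw (rev w) = 1 + (rev w == w))%N.
Proof.
rewrite /lexminw /lex_minimal -!dec_rev revK -(inj_eq dec_inj (rev w)).
case: eqP => [->|/eqP ne]; first by rewrite Order.POrderTheory.lexx.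
have := Order.TotalTheory.lt_total (ne : (dec (rev w) : seqlexi nat) != dec w).
by case: Order.POrderTheory.comparableP.
Qed.

End Reversal.

Local Open Scope ring_scope.

(** * The Moebius function of the lattice of right factors *)

Section Moebius.

Implicit Types (u v w : seq bool) (d n : nat).

(* The Moebius function of the lattice of right factors of w. *)
Definition mu w : rat :=
  if constw w then dinv (fun=> 1) (wlen w) else - (primew w)%:R.

Lemma wlen_right w d : splits w d -> wlen (subw w 1 d) = d.
Proof. by move=> sd; rewrite wlen_subw ?divn1 // (splits_gt0 sd). Qed.

Lemma splits_right w d c :
  splits w d -> splits (subw w 1 d) c = (c %| d)%N && splits w c.
Proof. by move=> sd; rewrite splits_subw ?splits1 // mul1n. Qed.

Lemma const_rightP w d : splits w d ->
  reflect (forall i j, ~~ (d %| i)%N -> ~~ (d %| j)%N -> cyc w i = cyc w j)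
          (constw (subw w 1 d)).
Proof.
move=> sd; have E i : ~~ (d %| i)%N -> cyc (subw w 1 d) i = cyc w i.
  by move=> di; rewrite cyc_subw ?divn1 // mul1n.
by apply: (iffP (constwP _)); rewrite wlen_right // => H i j di dj;
  have := H i j di dj; rewrite !E.
Qed.

(** The two constant values agree, both being the letter at position 1. *)
Lemma const_right_lcm w d e : splits w d -> splits w e ->
  constw (subw w 1 d) -> constw (subw w 1 e) -> constw (subw w 1 (lcmn d e)).
Proof.
move=> sd se /(const_rightP sd) cd /(const_rightP se) ce.
apply/const_rightP; first exact: splits_lcm.
have ne1 c i : ~~ (c %| i)%N -> ~~ (c %| 1)%N.
  by apply: contra; rewrite dvdn1 => /eqP ->; rewrite dvd1n.
have E i : ~~ (lcmn d e %| i)%N -> cyc w i = cyc w 1.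
  rewrite dvdn_lcm negb_and => /orP[] ni.
    by apply: cd (ni) _; apply: ne1 ni.
  by apply: ce (ni) _; apply: ne1 ni.
by move=> i j /E -> /E ->.
Qed.

Lemma coprime_right_const w d e : splits w d -> splits w e ->
  (1 < d)%N -> (1 < e)%N -> gcdn d e = 1%N -> constw (subw w 1 d).
Proof.
move=> sd se d1 e1 g1.
have de : ~~ (d %| e)%N by apply/negP => /gcdn_idPl; lia.
have ed : ~~ (e %| d)%N by apply/negP => /gcdn_idPr; lia.
apply/const_rightP => // i j di dj.
apply: (splits_incomparable sd se) => //; rewrite ?g1 ?dvd1n //.
  by rewrite dvdn_lcm (negPf di).
by rewrite dvdn_lcm (negPf dj).
Qed.

(** A nonconstant prime right factor is the only atom of the lattice: primality leaves [gcdn d e]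
    equal to 1 or [d], and 1 would make the factor constant. *)
Lemma prime_right_dvd w d e : splits w d -> splits w e ->
  primew (subw w 1 d) -> ~~ constw (subw w 1 d) -> (1 < e)%N -> (d %| e)%N.
Proof.
move=> sd se /primewP pd nc e1.
have d1 : (1 < d)%N.
  have := splits_gt0 sd; rewrite leq_eqVlt => /orP[/eqP d1|//].
  by rewrite -d1 subw_id in nc.
have := pd (gcdn d e); rewrite splits_right // dvdn_gcdl splits_gcd //.
rewrite wlen_right // => /(_ isT) [g1|/gcdn_idPl //].
by rewrite (coprime_right_const sd se) in nc.
Qed.

(** Constant right factors are closed under lcm, so their lengths are the divisors of a largest one,
    [e], and they contribute the classical sum. If [e > 1] this is 0, and a nonconstant prime right
    factor would divide [e] and so be constant. If [e = 1] it is 1, cancelled by the unique atom,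
    which is prime and nonconstant. *)
Lemma sum_mu w : \sum_(d <- divisors (wlen w) | splits w d) mu (subw w 1 d) =
  (wlen w == 1%N)%:R.
Proof.
case: (eqVneq (wlen w) 1%N) => [w1|w1].
  rewrite w1 /= big_cons big_nil splits1 subw_id /mu /= addr0.
  by have := @dconv_dinv (fun=> 1) 1 (oner_neq0 _) isT; rewrite /dconv /=
    big_cons big_nil mulr1 addr0.
have w2 : (1 < wlen w)%N by rewrite ltn_neqAle eq_sym w1.
pose K d := splits w d && constw (subw w 1 d).
have K1 : exists d, K d by exists 1%N; rewrite /K splits1 subw_id.
have Kb d : K d -> (d <= wlen w)%N.
  by case/andP=> /splits_dvd/dvdn_leq H _; apply: H.
have [e /andP[se ce] emax] := ex_maxnP K1 Kb.
have e0 := splits_gt0 se.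
have KE d : K d = (d %| e)%N.
  apply/idP/idP => [/andP[sd cd]|de].
    have : (lcmn d e <= e)%N by apply: emax; rewrite /K splits_lcm ?const_right_lcm.
    rewrite leq_eqVlt ltnNge (dvdn_leq _ (dvdn_lcmr d e)) ?orbF.
      by move/eqP => <-; exact: dvdn_lcml.
    by rewrite lcmn_gt0 e0 (splits_gt0 sd).
  have sd : splits w d.
    have := splits_constw (d := d) ce; rewrite wlen_right // => /(_ de).
    by rewrite splits_right // de.
  rewrite /K sd; have := subw_constw (d := 1) (e := d) _ (dvd1n d) ce.
  by rewrite splits_right // de sd subw_subw ?divn1 ?mul1n ?(dvdn_gt0 e0) //; apply.
rewrite (bigID (fun d => constw (subw w 1 d))) /=.
have -> : \sum_(d <- divisors (wlen w) | splits w d && constw (subw w 1 d))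
    mu (subw w 1 d) = (e == 1%N)%:R.
  have := @dconv_dinv (fun=> 1) e (oner_neq0 _) e0; rewrite /dconv => <-.
  rewrite -big_filter; apply: (etrans (y := \sum_(d <- divisors e) mu (subw w 1 d))).
    apply: perm_big; apply: uniq_perm; rewrite ?filter_uniq ?divisors_uniq //.
    move=> d; rewrite mem_filter -/(K d) KE -!dvdn_divisors //.
    by apply: andb_idr => de; rewrite (dvdn_trans de) ?splits_dvd.
  rewrite [LHS]big_seq [RHS]big_seq; apply: eq_bigr => d.
  rewrite -dvdn_divisors // -KE => /andP[sd cd].
  by rewrite mulr1 /mu cd wlen_right.
case: (eqVneq e 1%N) => [e1|e1] /=; last first.
  rewrite add0r big1 // => d /andP[sd nc]; rewrite /mu (negPf nc).
  case: (boolP (primew _)) => pd; last by rewrite oppr0.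
  have de : (d %| e)%N.
    by apply: (prime_right_dvd sd se); rewrite // ltn_neqAle eq_sym e1.
  by move: de; rewrite -KE /K (negPf nc) andbF.
have M1 : exists d, splits w d && (1 < d)%N by exists (wlen w); rewrite splits_wlen.
(* The least right factor above 1 is the atom; it alone contributes -1. *)
have [m /andP[sm m1] mmin] := ex_minnP M1.
have nc : ~~ constw (subw w 1 m).
  by apply/negP => cm; have := KE m; rewrite /K sm cm e1 dvdn1;
    case: eqP m1 => // ->.
have pm : primew (subw w 1 m).
  apply/primewP => d; rewrite splits_right // wlen_right // => /andP[dm sd].
  have [d1|d1] := leqP d 1; first by have := splits_gt0 sd; lia.
  right; apply/eqP; rewrite eqn_leq mmin ?sd // andbT dvdn_leq //; lia.
rewrite big_mkcond (bigD1_seq m) ?divisors_uniq //=; last first.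
  by rewrite -dvdn_divisors // splits_dvd.
rewrite sm nc /mu /= (negPf nc) pm addrA subrr add0r.
rewrite big1 // => d dm; case: ifP => // /andP[sd ncd].
rewrite (negPf ncd); case: (boolP (primew _)) => pd; last by rewrite oppr0.
have d1 : (1 < d)%N.
  have := splits_gt0 sd; rewrite leq_eqVlt => /orP[/eqP d1|//].
  by rewrite -d1 subw_id in ncd.
case/eqP: dm; apply/eqP; rewrite eqn_dvd.
by rewrite (prime_right_dvd sd sm) // (prime_right_dvd sm sd).
Qed.

(** * Counting words in classes closed under products and factors *)

Definition words n : seq (seq bool) := map val (enum {: n.-1.-tuple bool}).

Lemma mem_words n w : (w \in words n) = (size w == n.-1).
Proof.
apply/mapP/idP => [[t _ ->]|sw]; first exact/eqP/size_tuple.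
by exists (Tuple sw) => //; rewrite mem_enum.
Qed.

Lemma mem_words_wlen n w : (0 < n)%N -> (w \in words n) = (wlen w == n).
Proof. by move=> n0; rewrite mem_words -{2}(prednK n0). Qed.

Lemma words_uniq n : uniq (words n).
Proof. by rewrite map_inj_uniq ?enum_uniq //; exact: val_inj. Qed.

Lemma size_words n : size (words n) = (2 ^ n.-1)%N.
Proof. by rewrite size_map -cardE card_tuple card_bool. Qed.

Lemma words_splits n d : (0 < n)%N -> (d %| n)%N ->
  perm_eq [seq w <- words n | splits w d]
          [seq wcomp u v | u <- words (n %/ d), v <- words d].
Proof.
move=> n0 dn; have d0 := dvdn_gt0 n0 dn.
have q0 : (0 < n %/ d)%N by rewrite divn_gt0 // dvdn_leq.
apply: uniq_perm; first by rewrite filter_uniq // words_uniq.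
  apply: allpairs_uniq; rewrite ?words_uniq // => -[u v] [u' v'].
  move=> /allpairsP[[a b] /= [_ bd [-> ->]]] /allpairsP[[a' b'] /= [_ bd' [-> ->]]].
  rewrite !mem_words_wlen // in bd bd'.
  by case/wcomp_inj; [rewrite (eqP bd) (eqP bd')|move=> -> ->].
move=> w; rewrite mem_filter mem_words_wlen //; apply/andP/allpairsP.
  move=> [sd /eqP wn]; exists (subw w d (wlen w), subw w 1 d).
  rewrite !mem_words_wlen // wcomp_subw //=; split=> //.
    by rewrite wlen_subw ?wn // splits_dvd.
  by rewrite wlen_right.
move=> [[u v] /= []]; rewrite !mem_words_wlen // => /eqP uq /eqP vd ->.
by rewrite wlen_wcomp -{1}vd splits_wcomp uq vd divnK.
Qed.

Definition cntw (G : pred (seq bool)) n : rat := \sum_(w <- words n | G w) 1.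

Definition sumw (G : pred (seq bool)) n : rat := \sum_(w <- words n | G w) mu w.

(** Since [G] is multiplicative, pairs of a left and a right factor in [G] amount to words [w] of
    [G] with a chosen [d] such that [splits w d]. Exchanging the sums leaves [sum_mu] for each
    [w]. *)
Lemma dconv_sumw_cntw (G : pred (seq bool)) n : G [::] ->
  (forall u v, G (wcomp u v) = G u && G v) -> (0 < n)%N ->
  dconv (sumw G) (cntw G) n = (n == 1%N)%:R.
Proof.
move=> G0 GM n0.
transitivity (\sum_(d <- divisors n)
    \sum_(w <- words n | G w) if splits w d then mu (subw w 1 d) else 0).
  rewrite /dconv [LHS]big_seq [RHS]big_seq; apply: eq_bigr => d.
  rewrite -dvdn_divisors // => dn; have d0 := dvdn_gt0 n0 dn.
  rewrite -big_mkcondr big_mkcondl -big_filter (perm_big _ (words_splits n0 dn)) /=.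
  rewrite big_allpairs_dep /sumw /cntw mulr_sumr [LHS]big_mkcond.
  apply: eq_bigr => u _; case: ifP => Gu; last first.
    by rewrite big1 // => v _; rewrite GM Gu.
  rewrite mulr1 [LHS]big_mkcond [LHS]big_seq [RHS]big_seq; apply: eq_bigr => v.
  by rewrite mem_words_wlen // => /eqP <-; rewrite GM Gu subw_wcompr.
rewrite exchange_big /=.
transitivity (\sum_(w <- words n | G w) (n == 1%N)%:R : rat).
  rewrite [LHS]big_seq_cond [RHS]big_seq_cond; apply: eq_bigr => w /andP[].
  by rewrite mem_words_wlen // => /eqP <- _; rewrite -big_mkcond sum_mu.
case: (eqVneq n 1%N) => [->|_]; last by rewrite big1.
have -> : words 1 = [:: [::]].
  apply: perm_small_eq => //; apply: uniq_perm; rewrite ?words_uniq // => w.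
  by rewrite mem_words inE; case: w.
by rewrite big_cons big_nil G0 addr0.
Qed.

Lemma cntwE (G : pred (seq bool)) n : cntw G n = (count G (words n))%:R.
Proof. by rewrite /cntw -sum1_count natr_sum. Qed.

Lemma cntw_all n : cntw predT n = 2%:R ^+ n.-1.
Proof.
by rewrite cntwE count_predT size_words natrX.
Qed.

Definition symw w := rev w == w.

Lemma symw_wcomp u v : symw (wcomp u v) = symw u && symw v.
Proof.
rewrite /symw rev_wcomp; apply/eqP/andP => [|[/eqP -> /eqP ->] //].
by case/wcomp_inj; [rewrite wlen_rev|move=> -> ->; rewrite !eqxx].
Qed.

(** A palindrome of length [n.-1] is determined by its first [n./2] letters, including the middle
    one if there is one. Words of that length form [words (n./2).+1]. *)
Lemma words_symw n : (0 < n)%N -> perm_eq [seq w <- words n | symw w]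
  [seq u ++ rev (take n.-1./2 u) | u <- words (n./2).+1].
Proof.
move=> n0; apply: uniq_perm; first by rewrite filter_uniq // words_uniq.
  rewrite map_inj_in_uniq ?words_uniq // => u v; rewrite !mem_words /=.
  by move=> /eqP su /eqP sv /(congr1 (take n./2)); rewrite !take_size_cat.
have h1 : (n.-1./2 <= n./2)%N by rewrite half_leq // leq_pred.
have h2 : (n.-1./2 + n./2 = n.-1)%N.
  by case: (n) n0 => // m _ /=; have := uphalf_half m;
    have := odd_double_half m; lia.
have h3 : (n./2 <= n.-1./2.+1)%N.
  by case: (n) n0 => // m _ /=; have := uphalf_half m; lia.
move=> w; rewrite mem_filter mem_words; apply/andP/mapP.
  move=> [/eqP rw /eqP sw]; exists (take n./2 w).
    by rewrite mem_words size_takel // sw; lia.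
  rewrite take_takel // -{1}(cat_take_drop n./2 w); congr (_ ++ _).
  by rewrite -{2}rw take_rev revK sw; congr drop; lia.
move=> [u]; rewrite mem_words /= => /eqP su ->; split.
  rewrite /symw rev_cat revK; apply/eqP.
  have : (n.-1./2 == size u) || (n.-1./2.+1 == size u) by rewrite su; lia.
  case/orP => /eqP hs; first by rewrite hs take_size.
  case/lastP: u su hs => // t x; rewrite size_rcons => _ [->].
  by rewrite -cats1 take_size_cat // rev_cat -catA.
by rewrite size_cat size_rev su size_takel ?su; lia.
Qed.

Lemma cntw_symw n : (0 < n)%N -> cntw symw n = 2%:R ^+ n./2.
Proof.
move=> n0; rewrite cntwE -size_filter (perm_size (words_symw n0)) size_map.
by rewrite size_words natrX.
Qed.

Definition goodwb w := `[< goodw w >].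

(** Only constant and prime words matter. Constant words are good and symmetric, so they count twice
    on both sides. A nonconstant prime word is good exactly when it is minimal; since reversal
    permutes [words n], the doubled sum may be taken over [w] and [rev w], where [lexminw_rev]
    applies. *)
Lemma sumw_goodw n :
  2%:R * sumw goodwb n = sumw predT n + sumw symw n.
Proof.
pose P w := ~~ constw w && primew w.
have E1 w : (goodwb w)%:R * mu w =
    (constw w)%:R * mu w - (P w && lexminw w)%:R.
  rewrite /mu /P; case: (boolP (constw w)) => cw /=.
    by rewrite subr0 /goodwb asboolT //; exact: goodw_constw.
  case: (boolP (primew w)) => pw /=; last by rewrite oppr0 !mulr0 subr0.
  rewrite mul0r sub0r mulrN1; congr (- (nat_of_bool _)%:R).
  apply/asboolP/idP => [/(_ 1%N (wlen w))|lw].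
    by rewrite subw_full /irrw pw orbT; apply; rewrite ?splits1 ?splits_wlen.
  by apply: goodw_irr; rewrite // /irrw pw orbT.
have E2 w : mu w + (symw w)%:R * mu w = 2%:R * ((constw w)%:R * mu w)
    - (P w && lexminw w)%:R - (P w && lexminw (rev w))%:R.
  rewrite /mu /P; case: (boolP (constw w)) => cw /=.
    have -> : symw w by rewrite /symw (eqP cw) rev_nseq.
    by rewrite !subr0 !mul1r mulr_natl.
  case: (boolP (primew w)) => pw /=; last by rewrite !(oppr0, mulr0, subr0, addr0).
  rewrite mul0r mulr0 sub0r -opprD -natrD lexminw_rev -/(symw w).
  by rewrite natrD mulrN1 opprD.
have sumE (G : pred (seq bool)) : sumw G n = \sum_(w <- words n) (G w)%:R * mu w.
  rewrite /sumw big_mkcond; apply: eq_bigr => w _.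
  by case: (G w); rewrite ?mul1r ?mul0r.
have revE : \sum_(w <- words n) (P w && lexminw (rev w))%:R =
    \sum_(w <- words n) (P w && lexminw w)%:R :> rat.
  have pr : perm_eq (words n) (map rev (words n)).
    apply: uniq_perm; rewrite ?(map_inj_uniq (can_inj (@revK bool))) ?words_uniq //.
    move=> w; apply/idP/mapP => [|[v + ->]]; rewrite !mem_words ?size_rev // => ws.
    by exists (rev w); rewrite ?revK // mem_words size_rev.
  rewrite (perm_big _ pr) /= big_map; apply: eq_bigr => w _.
  by rewrite /P constw_rev primew_rev revK.
rewrite !sumE -big_split /= (eq_bigr _ (fun w _ => E1 w)).
under [in RHS]eq_bigr => w _ do rewrite mul1r E2.
rewrite !big_split /= !sumrN revE -mulr_sumr.
by rewrite mulrDr mulr_natl mulrN mulr_natl -addrA -opprD.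
Qed.

Lemma cntw_goodw n : (0 < n)%N -> cntw goodwb n = Rseq n.
Proof.
move=> n0; rewrite /Rseq /num_normalised.
have -> : fset_set (normalised_of_size n) =
    [fset a in [seq dec w | w <- words n & goodwb w]]%fset.
  apply/fsetP => a; rewrite in_fset_set; last exact: finite_normalised_of_size.
  apply/idP/idP; rewrite !inE /=.
    move=> [/dec_surj[w ->]] /normalised_dec gw; rewrite sumn_dec => wn.
    by apply/mapP; exists w; rewrite // mem_filter mem_words_wlen // wn eqxx andbT;
      exact/asboolP.
  move=> /mapP[w]; rewrite mem_filter mem_words_wlen //.
  move=> /andP[/asboolP gw /eqP wn] ->.
  split; [exact: is_composition_dec|exact/normalised_dec|by rewrite sumn_dec].
rewrite card_fseq undup_id ?map_inj_uniq ?filter_uniq ?words_uniq //;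
  last exact: dec_inj.
by rewrite size_map size_filter cntwE.
Qed.

End Moebius.

(** * Dirichlet convolution *)

Section DirichletConvolution.

Implicit Types (f g h : nat -> rat) (n : nat).

Lemma eq_dconv f f' g g' n : (0 < n)%N ->
  (forall k, (0 < k)%N -> f k = f' k) -> (forall k, (0 < k)%N -> g k = g' k) ->
  dconv f g n = dconv f' g' n.
Proof.
move=> n0 ff gg; rewrite /dconv [LHS]big_seq [RHS]big_seq.
apply: eq_bigr => d; rewrite -dvdn_divisors // => dn.
have d0 := dvdn_gt0 n0 dn.
by rewrite ff // gg // divn_gt0 // dvdn_leq.
Qed.

Lemma dconvC f g n : (0 < n)%N -> dconv f g n = dconv g f n.
Proof.
move=> n0; pose co d := (n %/ d)%N.
have coK d : (d %| n)%N -> co (co d) = d.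
  move=> dn; have d0 := dvdn_gt0 n0 dn.
  have q0 : (0 < n %/ d)%N by rewrite divn_gt0 // dvdn_leq.
  by rewrite /co -{1}(divnK dn) mulKn.
have co_dvd d : (d %| n)%N -> (co d %| n)%N.
  by move=> dn; apply/dvdnP; exists d; rewrite mulnC divnK.
have co_perm : perm_eq (divisors n) (map co (divisors n)).
  apply: uniq_perm; rewrite ?divisors_uniq // ?map_inj_in_uniq ?divisors_uniq //.
    move=> d e; rewrite -!dvdn_divisors // => dn en E.
    by rewrite -(coK d dn) E coK.
  move=> d; rewrite -dvdn_divisors //; apply/idP/mapP => [dn|[e + ->]].
    by exists (co d); rewrite ?coK // -dvdn_divisors // co_dvd.
  by rewrite -dvdn_divisors //; exact: co_dvd.
rewrite /dconv (perm_big _ co_perm) /= big_map [LHS]big_seq [RHS]big_seq.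
apply: eq_bigr => d; rewrite -dvdn_divisors // => dn.
by rewrite -/(co (co d)) coK // mulrC.
Qed.

Lemma dconvA f g h n : (0 < n)%N ->
  dconv (dconv f g) h n = dconv f (dconv g h) n.
Proof.
move=> n0.
transitivity (\sum_(d <- divisors n) \sum_(e <- divisors n | (e %| d)%N)
    f e * g (d %/ e)%N * h (n %/ d)%N).
  rewrite /dconv [LHS]big_seq [RHS]big_seq; apply: eq_bigr => d.
  rewrite -dvdn_divisors // => dn; have d0 := dvdn_gt0 n0 dn.
  rewrite mulr_suml -[RHS]big_filter; apply: perm_big.
  apply: uniq_perm; rewrite ?filter_uniq ?divisors_uniq // => e.
  rewrite mem_filter -!dvdn_divisors //.
  by apply/esym/andb_idr => ed; exact: dvdn_trans ed dn.
rewrite (exchange_big_dep predT) //= /dconv [LHS]big_seq [RHS]big_seq.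
apply: eq_bigr => e; rewrite -dvdn_divisors // => en.
have e0 := dvdn_gt0 n0 en.
have q0 : (0 < n %/ e)%N by rewrite divn_gt0 // dvdn_leq.
rewrite mulr_sumr -big_filter.
have pq : perm_eq [seq d <- divisors n | (e %| d)%N]
    [seq (e * c)%N | c <- divisors (n %/ e)].
  apply: uniq_perm; first by rewrite filter_uniq // divisors_uniq.
    rewrite map_inj_in_uniq ?divisors_uniq // => c c' _ _ /eqP.
    by rewrite eqn_pmul2l // => /eqP.
  move=> d; rewrite mem_filter -dvdn_divisors //; apply/andP/mapP.
    move=> [ed dn]; exists (d %/ e)%N; last by rewrite mulnC divnK.
    by rewrite -dvdn_divisors // -(dvdn_pmul2r e0) !divnK.
  move=> [c]; rewrite -dvdn_divisors // => cn ->; rewrite dvdn_mulr //.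
  by rewrite -(divnK en) mulnC dvdn_pmul2r.
rewrite (perm_big _ pq) /= big_map; apply: eq_bigr => c _.
by rewrite mulKn // divnMA mulrA.
Qed.

Lemma dconvDr f g h n :
  dconv f (fun k => g k + h k) n = dconv f g n + dconv f h n.
Proof. by rewrite /dconv -big_split; apply: eq_bigr => d _; rewrite mulrDr. Qed.

Lemma dconvZl c f g n : dconv (fun k => c * f k) g n = c * dconv f g n.
Proof.
by rewrite /dconv mulr_sumr; apply: eq_bigr => d _; rewrite mulrA.
Qed.

Lemma dconv1l f n : (0 < n)%N -> dconv (fun k => (k == 1%N)%:R) f n = f n.
Proof.
move=> n0; rewrite /dconv (bigD1_seq 1%N) ?divisors_uniq //=; last first.
  by rewrite -dvdn_divisors // dvd1n.
rewrite mul1r divn1 big1 ?addr0 // => d d1.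
by rewrite (negPf d1) mul0r.
Qed.

End DirichletConvolution.

(** * The identity between the Dirichlet series *)

Lemma dconv_normalised n : (0 < n)%N ->
  dconv Rseq (fun k => Cseq k + Sseq k) n = 2%:R * dconv Cseq Sseq n.
Proof.
move=> n0; pose X := sumw predT; pose Y := sumw symw; pose Z := sumw goodwb.
have XC k : (0 < k)%N -> dconv X Cseq k = (k == 1%N)%:R.
  move=> k0; rewrite -(@dconv_sumw_cntw predT) //.
  by apply: eq_dconv => // j _; rewrite cntw_all.
have YS k : (0 < k)%N -> dconv Y Sseq k = (k == 1%N)%:R.
  move=> k0; rewrite -(@dconv_sumw_cntw symw) //; last exact: symw_wcomp.
  by apply: eq_dconv => // j j0; rewrite cntw_symw.
have ZR k : (0 < k)%N -> dconv Z Rseq k = (k == 1%N)%:R.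
  move=> k0; rewrite -(@dconv_sumw_cntw goodwb) //.
  - by apply: eq_dconv => // j j0; rewrite cntw_goodw.
  - by apply/asboolP; exact: goodw_constw.
  - move=> u v; apply/asboolP/andP => [/goodw_wcomp[gu gv]|].
      by split; exact/asboolP.
    by case=> /asboolP gu /asboolP gv; exact/goodw_wcomp.
(* The relation [2 Z = X + Y] is multiplied by [Cseq] and [Sseq], whose inverses are [X] and [Y].
   Convolving with [Rseq], the inverse of [Z], then gives the claim. *)
have CSZ k : (0 < k)%N -> Cseq k + Sseq k =
    dconv (fun j => 2%:R * Z j) (dconv Cseq Sseq) k.
  move=> k0; rewrite dconvC //.
  rewrite (@eq_dconv _ (dconv Cseq Sseq) _ (fun j => X j + Y j)) //;
    last by move=> j _; exact: sumw_goodw.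
  rewrite dconvDr addrC; congr (_ + _).
    rewrite dconvC // -dconvA // (@eq_dconv _ (fun j => (j == 1%N)%:R) _ Sseq) //.
    by rewrite dconv1l.
  rewrite dconvC // (@eq_dconv _ Y _ (dconv Sseq Cseq)) //; last first.
    by move=> j j0; exact: dconvC.
  rewrite -dconvA // (@eq_dconv _ (fun j => (j == 1%N)%:R) _ Cseq) //.
  by rewrite dconv1l.
rewrite (eq_dconv n0 (fun k _ => erefl) CSZ) -dconvA //.
rewrite (@eq_dconv _ (fun k => 2%:R * (k == 1%N)%:R) _ (dconv Cseq Sseq)) //.
  by rewrite dconvZl dconv1l.
by move=> k k0; rewrite dconvC // dconvZl ZR.
Qed.

Theorem theorem3p5 :
  (forall n : nat, (0 < n)%N ->
     (num_normalised n)%:R =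
       dconv (dconv (fun k => 2%:R * 2%:R ^+ k.-1) (fun k => 2%:R ^+ k./2))
             (dinv (fun k => 2%:R ^+ k.-1 + 2%:R ^+ k./2)) n)
  /\
  (forall n : nat, (0 < n)%N ->
     dconv Rseq (fun k => Cseq k + Sseq k) n = 2%:R * dconv Cseq Sseq n).
Proof.
split=> n n0; last exact: dconv_normalised.
rewrite -[LHS]/(Rseq n) -/Cseq -/Sseq.
rewrite (@eq_dconv _ (dconv Rseq (fun k => Cseq k + Sseq k)) _
  (dinv (fun k => Cseq k + Sseq k))) //; last first.
  by move=> k k0; rewrite dconv_normalised // -dconvZl.
rewrite dconvA // dconvC // (@eq_dconv _ (fun k => (k == 1%N)%:R) _ Rseq) //.
  by rewrite dconv1l.
(* The inverse exists because [Cseq + Sseq] takes the nonzero value 2 at 1. *)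
by move=> k k0; rewrite dconvC // dconv_dinv.
Qed.
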